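(* For the graph $A_n$ with $n>2$, and for the half-line graph $\mathbb{N}$, there is no edge-symmetric quantum Riemannian geometry. That is, no quantum metric $g=\sum_i (f_i\,a_i\otimes a_i'+f_i'\,a_i'\otimes a_i)$, $f_i,f_i'\in\mathbb{R}\setminus\{0\}$, with $f_i=f_i'$ for all $i$ admits a quantum Levi-Civita connection.
   Context: **Calculus.** The vertex set is $X=\{1,\dots,n\}$ (graph $A_n$) or $X=\{1,2,3,\dots\}$ (half-line $\mathbb{N}$), with an edge $i-(i+1)$ for every $i$ with $i,i+1\in X$; indices $i$ of arrows run over these. $A=\mathbb{C}(X)$ is the algebra of complex functions on $X$. $\Omega^1$ is the space of all (possibly infinite in the case of $\mathbb{N}$) linear combinations of the arrows $a_i=\omega_{i\to i+1}$, $a_i'=\omega_{i+1\to i}$. It is an $A$-bimodule via $f a_i=f(i)a_i$, $a_i f=f(i+1)a_i$, $f a_i'=f(i+1)a_i'$, $a_i'f=f(i)a_i'$, with $\mathrm{d}f=\sum_i (f(i+1)-f(i))(a_i-a_i')$. $\Omega^1\otimes_A\Omega^1$ consists of (possibly infinite for $\mathbb{N}$) linear combinations of the 2-step paths $a_i\otimes a_{i+1}$, $a_{i+1}'\otimes a_i'$, $a_i\otimes a_i'$, $a_i'\otimes a_i$ ($\otimes$ means $\otimes_A$). $\Omega^2$ is the quotient of $\Omega^1\otimes_A\Omega^1$ (quotient map $\wedge$) by all relations $a_i\wedge a_{i+1}=0$, $a_{i+1}'\wedge a_i'=0$, $a_{i+1}\wedge a_{i+1}'+a_i'\wedge a_i=0$,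 $a_1\wedge a_1'=0$, and, for $A_n$ only, $a_{n-1}'\wedge a_{n-1}=0$. With $\theta=\sum_i(a_i+a_i')$, $\mathrm{d}:\Omega^1\to\Omega^2$ is $\mathrm{d}\omega=\theta\wedge\omega+\omega\wedge\theta$. **Connections.** A bimodule connection on $\Omega^1$ is a linear map $\nabla:\Omega^1\to\Omega^1\otimes_A\Omega^1$ together with a bimodule map $\sigma:\Omega^1\otimes_A\Omega^1\to\Omega^1\otimes_A\Omega^1$ such that $\nabla(f\omega)=\mathrm{d}f\otimes\omega+f\nabla\omega$ and $\nabla(\omega f)=(\nabla\omega)f+\sigma(\omega\otimes\mathrm{d}f)$. It extends to tensor products by $\nabla(\omega\otimes\eta)=\nabla\omega\otimes\eta+(\sigma(\omega\otimes(\ ))\otimes\mathrm{id})\nabla\eta$. It is a quantum Levi-Civita connection (QLC) for $g$ if $\wedge\nabla=\mathrm{d}$ on $\Omega^1$ and $\nabla g=0$. *)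

(* Defs.v *)
From HB Require Import structures.
From mathcomp Require Import all_boot all_order all_algebra.
From mathcomp Require Import boolp classical_sets functions cardinality fsbigop reals.
From mathcomp Require Import complex.

Set Implicit Arguments.
Unset Strict Implicit.
Unset Printing Implicit Defensive.

Import Order.TTheory GRing.Theory Num.Theory.
Local Open Scope ring_scope.
Local Open Scope complex_scope.
Local Open Scope quotient_scope.

(* [FinLine n] is the graph A_n on {1,...,n}; [HalfLine] is the graph on
   {1,2,3,...}. *)
Inductive line_graph := FinLine of nat | HalfLine.

Definition is_vertex (X : line_graph) (i : nat) : bool :=
  (0 < i)%N && (if X is FinLine n then (i <= n)%N else true).

Definition is_arrow (X : line_graph) (x y : nat) : bool :=
  [&& is_vertex X x, is_vertex X y & (y == x.+1) || (x == y.+1)].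

Definition is_edge (X : line_graph) (i : nat) : bool :=
  is_vertex X i && is_vertex X i.+1.

(* A k-step path is the tuple of its k+1 successive vertices. *)
Definition vert (X : line_graph) : Type := {i : nat | is_vertex X i}.
Definition path1 (X : line_graph) : Type := {p : nat * nat | is_arrow X p.1 p.2}.
Definition path2 (X : line_graph) : Type :=
  {p : nat * nat * nat | is_arrow X p.1.1 p.1.2 && is_arrow X p.1.2 p.2}.
Definition path3 (X : line_graph) : Type :=
  {p : nat * nat * nat * nat |
    [&& is_arrow X p.1.1.1 p.1.1.2, is_arrow X p.1.1.2 p.1.2
      & is_arrow X p.1.2 p.2]}.

(* [T2] and [T3] are the two- and threefold tensor powers of [Omega1] over
   [Afun].  A possibly infinite linear combination of k-step paths is identified
   with the function giving its coefficients.  The regular module R[i]^o is the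
   codomain so that these function spaces are C-vector spaces. *)
Section Spaces.
Variables (R : realType) (X : line_graph).

Definition Afun : Type := vert X -> R[i]^o.
HB.instance Definition _ := GRing.Lmodule.on Afun.
Definition Omega1 : Type := path1 X -> R[i]^o.
HB.instance Definition _ := GRing.Lmodule.on Omega1.
Definition T2 : Type := path2 X -> R[i]^o.
HB.instance Definition _ := GRing.Lmodule.on T2.
Definition T3 : Type := path3 X -> R[i]^o.
HB.instance Definition _ := GRing.Lmodule.on T3.

End Spaces.

(* [coef u x] is the coefficient of u at x, extended by 0 to the tuples x that
   are not paths; conversely [combo F] is the sum of F x *: x over all paths. *)
Definition coef (R : realType) (T : Type) (P : pred T)
    (u : {x : T | P x} -> R[i]^o) (x : T) : R[i] :=
  if insub x is Some p then u p else 0.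

Definition combo (R : realType) (T : Type) (P : pred T) (F : T -> R[i]) :
    {x : T | P x} -> R[i]^o := fun p => F (val p).

(* The combination of the F i for i in E, computed coefficientwise.  The
   finitely supported sum is 0 on infinite supports, but in all uses below only
   finitely many terms contribute to a given coefficient. *)
Definition lsum (R : realType) (I : choiceType) (T : Type) (E : set I)
    (F : I -> T -> R[i]^o) : T -> R[i]^o :=
  fun p => \sum_(i \in E) F i p.

Section Coef.
Variables (R : realType) (T : Type) (P : pred T).
Implicit Types u v : {x : T | P x} -> R[i]^o.

Lemma coef_combo (F : T -> R[i]) x :
  coef (combo F : {x : T | P x} -> R[i]^o) x = if P x then F x else 0.
Proof.
rewrite /coef /combo; case: insubP => [p -> /= <-|/negPf->] //.
Qed.

Lemma coefE u x (Px : P x) : coef u x = u (exist _ x Px).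
Proof. by rewrite /coef (insubT P Px). Qed.

Lemma coef_val u p : coef u (val p) = u p.
Proof. by rewrite /coef valK. Qed.

Lemma coef_out u x : ~~ P x -> coef u x = 0.
Proof. by move=> Px; rewrite /coef insubN. Qed.

Lemma coefP u v : (forall x, P x -> coef u x = coef v x) -> u = v.
Proof.
move=> uv; apply/funext => p; rewrite -!coef_val; apply: uv; exact: valP.
Qed.

Lemma coef0 x : coef (0 : {x : T | P x} -> R[i]^o) x = 0.
Proof. by rewrite /coef; case: insubP. Qed.

Lemma coefD u v x : coef (u + v) x = coef u x + coef v x.
Proof. by rewrite /coef; case: insubP => // _; rewrite addr0. Qed.

Lemma coefN u x : coef (- u) x = - coef u x.
Proof. by rewrite /coef; case: insubP => // _; rewrite oppr0. Qed.

Lemma coefZ c u x : coef (c *: u) x = c * coef u x.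
Proof. by rewrite /coef; case: insubP => // _; rewrite mulr0. Qed.

Lemma coef_lsum (I : choiceType) (E : set I) (F : I -> {x : T | P x} -> R[i]^o) x :
  coef (lsum E F) x = \sum_(i \in E) coef (F i) x.
Proof.
rewrite /coef; case: insubP => [//|_]; by rewrite fsbig1.
Qed.

End Coef.

Section Calculus.
Variables (R : realType) (X : line_graph).
Local Notation C := R[i].
Local Notation A := (Afun R X).
Local Notation Omega1 := (Omega1 R X).
Local Notation T2 := (T2 R X).
Local Notation T3 := (T3 R X).
Implicit Types (f : A) (w eta zeta : Omega1) (t : T2).

(* The arrows a_i = (i -> i+1) and a_i' = (i+1 -> i), which are 0 when i is not
   an edge. *)
Definition a (i : nat) : Omega1 := combo (fun p => (p == (i, i.+1))%:R).
Definition a' (i : nat) : Omega1 := combo (fun p => (p == (i.+1, i))%:R).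

Definition edges : set nat := [set i | is_edge X i]%classic.

Definition lact1 f w : Omega1 := combo (fun p => coef f p.1 * coef w p).
Definition ract1 w f : Omega1 := combo (fun p => coef w p * coef f p.2).
Definition lact2 f t : T2 := combo (fun p => coef f p.1.1 * coef t p).
Definition ract2 t f : T2 := combo (fun p => coef t p * coef f p.2).

Definition tens w eta : T2 :=
  combo (fun p => coef w p.1 * coef eta (p.1.2, p.2)).
Definition tens21 t eta : T3 :=
  combo (fun p => coef t p.1 * coef eta (p.1.2, p.2)).

Definition d0 f : Omega1 :=
  lsum edges (fun i => (coef f i.+1 - coef f i) *: (a i - a' i)).

Definition theta : Omega1 := lsum edges (fun i => a i + a' i).

Inductive wedge_rel : T2 -> Prop :=
| WedgeUp i of is_edge X i & is_edge X i.+1 :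
    wedge_rel (tens (a i) (a i.+1))
| WedgeDown i of is_edge X i & is_edge X i.+1 :
    wedge_rel (tens (a' i.+1) (a' i))
| WedgeLoop i of is_edge X i & is_edge X i.+1 :
    wedge_rel (tens (a i.+1) (a' i.+1) + tens (a' i) (a i))
| WedgeFirst :
    wedge_rel (tens (a 1) (a' 1))
| WedgeLast n of X = FinLine n :
    wedge_rel (tens (a' n.-1) (a n.-1)).

(* The possibly infinite linear combinations of the relations; [wedge_kerP]
   computes this subspace. *)
Definition wedge_ker : {pred T2} := fun t =>
  `[< exists c : T2 -> C,
        t = lsum [set r | wedge_rel r]%classic (fun r => c r *: r) >].

Lemma tensE w eta x y z :
  coef (tens w eta) (x, y, z) = coef w (x, y) * coef eta (y, z).
Proof.
rewrite coef_combo /=; case: ifPn => // /nandP[] nP.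
  by rewrite (coef_out w) ?mul0r.
by rewrite (coef_out eta) ?mulr0.
Qed.

Lemma tens21E t eta x y z v :
  coef (tens21 t eta) (x, y, z, v) = coef t (x, y, z) * coef eta (z, v).
Proof.
rewrite coef_combo /=; case: ifPn => //.
rewrite andbA => /nandP[] nP.
  by rewrite (coef_out t) ?mul0r.
by rewrite (coef_out eta) ?mulr0.
Qed.

Lemma lact1E f w x y : coef (lact1 f w) (x, y) = coef f x * coef w (x, y).
Proof. by rewrite coef_combo /=; case: ifPn => // nP; rewrite (coef_out w) ?mulr0. Qed.

Lemma ract1E w f x y : coef (ract1 w f) (x, y) = coef w (x, y) * coef f y.
Proof. by rewrite coef_combo /=; case: ifPn => // nP; rewrite (coef_out w) ?mul0r. Qed.

Lemma lact2E f t x y z :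
  coef (lact2 f t) (x, y, z) = coef f x * coef t (x, y, z).
Proof. by rewrite coef_combo /=; case: ifPn => // nP; rewrite (coef_out t) ?mulr0. Qed.

Lemma ract2E t f x y z :
  coef (ract2 t f) (x, y, z) = coef t (x, y, z) * coef f z.
Proof. by rewrite coef_combo /=; case: ifPn => // nP; rewrite (coef_out t) ?mul0r. Qed.

Lemma aE i x y : coef (a i) (x, y) = (is_edge X i && ((x, y) == (i, i.+1)))%:R.
Proof.
rewrite coef_combo /= /is_arrow /is_edge.
case: (eqVneq (x, y) (i, i.+1)) => [[-> ->]|_]; last by rewrite andbF if_same.
by rewrite eqxx andbT /=; case: is_vertex; case: is_vertex.
Qed.

Lemma a'E i x y : coef (a' i) (x, y) = (is_edge X i && ((x, y) == (i.+1, i)))%:R.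
Proof.
rewrite coef_combo /= /is_arrow /is_edge.
case: (eqVneq (x, y) (i.+1, i)) => [[-> ->]|_]; last by rewrite andbF if_same.
by rewrite eqxx orbT andbT /=; case: is_vertex; case: is_vertex.
Qed.

Lemma arrowP x y : is_arrow X x y ->
  (y = x.+1 /\ is_edge X x) \/ (x = y.+1 /\ is_edge X y).
Proof.
by rewrite /is_edge => /and3P[vx vy /orP[]/eqP e]; [left|right];
  rewrite -e vx vy.
Qed.

Lemma fsum_single (I : choiceType) (E : set I) (F : I -> C) i :
  E i -> (forall j, E j -> j != i -> F j = 0) -> \sum_(j \in E) F j = F i.
Proof.
move=> Ei F0; rewrite -(fsbig_set1 +%R i F); apply/esym/fsbig_widen.
  by move=> j ->.
by move=> j [Ej /eqP ji]; apply: F0.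
Qed.

Lemma d0E f x y :
  coef (d0 f) (x, y) = if is_arrow X x y then coef f y - coef f x else 0.
Proof.
rewrite coef_lsum; case: ifPn => [/arrowP[][-> e]|nxy].
- rewrite (fsum_single (i := x)) // => [|j _ jx].
    by rewrite coefZ coefD coefN aE a'E e eqxx xpair_eqE (ltn_eqF (ltnSn x))
      subr0 mulr1.
  rewrite coefZ coefD coefN aE a'E !xpair_eqE eqSS (eq_sym x j) (negPf jx).
  rewrite !andbF /=; case: eqP => [->|]; last by rewrite !andbF subr0 mulr0.
  by rewrite (gtn_eqF (ltnW (ltnSn j.+1))) !andbF subr0 mulr0.
- rewrite (fsum_single (i := y)) // => [|j _ jx].
    by rewrite coefZ coefD coefN aE a'E e eqxx xpair_eqE (gtn_eqF (ltnSn y))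
      sub0r mulrN1 opprB.
  rewrite coefZ coefD coefN aE a'E !xpair_eqE eqSS (eq_sym y j) (negPf jx).
  rewrite !andbF /=; case: eqP => [<-|]; last by rewrite !andbF subr0 mulr0.
  by rewrite (ltn_eqF (ltnW (ltnSn y.+1))) !andbF subr0 mulr0.
- by rewrite fsbig1 // => i _; rewrite coef_out.
Qed.

Lemma thetaE x y : coef theta (x, y) = (is_arrow X x y)%:R.
Proof.
rewrite coef_lsum; case: (boolP (is_arrow _ _ _)) => [/arrowP[][-> e]|nxy].
- rewrite (fsum_single (i := x)) // => [|j _ jx].
    by rewrite coefD aE a'E e eqxx xpair_eqE (ltn_eqF (ltnSn x)) addr0.
  rewrite coefD aE a'E !xpair_eqE eqSS (eq_sym x j) (negPf jx).
  rewrite !andbF /=; case: eqP => [->|]; last by rewrite !andbF addr0.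
  by rewrite (gtn_eqF (ltnW (ltnSn j.+1))) !andbF addr0.
- rewrite (fsum_single (i := y)) // => [|j _ jx].
    by rewrite coefD aE a'E e eqxx xpair_eqE (gtn_eqF (ltnSn y)) add0r.
  rewrite coefD aE a'E !xpair_eqE eqSS (eq_sym y j) (negPf jx).
  rewrite !andbF /=; case: eqP => [<-|]; last by rewrite !andbF addr0.
  by rewrite (ltn_eqF (ltnW (ltnSn y.+1))) !andbF addr0.
- by rewrite fsbig1 // => i _; rewrite coef_out.
Qed.

Lemma tens_neq0 w eta x y z : coef (tens w eta) (x, y, z) != 0 ->
  coef w (x, y) != 0 /\ coef eta (y, z) != 0.
Proof. by rewrite tensE mulf_eq0 negb_or => /andP. Qed.

Lemma a_neq0 i x y : coef (a i) (x, y) != 0 -> [/\ is_edge X i, x = i & y = i.+1].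
Proof.
rewrite aE; case: (is_edge X i) => /=; last by rewrite eqxx.
by case: ((x, y) =P (i, i.+1)) => [[-> ->]|]; rewrite ?eqxx.
Qed.

Lemma a'_neq0 i x y : coef (a' i) (x, y) != 0 -> [/\ is_edge X i, x = i.+1 & y = i].
Proof.
rewrite a'E; case: (is_edge X i) => /=; last by rewrite eqxx.
by case: ((x, y) =P (i.+1, i)) => [[-> ->]|]; rewrite ?eqxx.
Qed.

Lemma add_neq0 (c1 c2 : C) : c1 + c2 != 0 -> c1 != 0 \/ c2 != 0.
Proof. by case: (eqVneq c1 0) => [->|]; [rewrite add0r; right|left]. Qed.

Definition rel_at (x y z : nat) : T2 :=
  if z == x.+2 then tens (a x) (a x.+1)
  else if x == z.+2 then tens (a' z.+1) (a' z)
  else if y == x.+1 then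
    if x == 1%N then tens (a 1) (a' 1)
    else tens (a x) (a' x) + tens (a' x.-1) (a x.-1)
  else if is_edge X x then tens (a x) (a' x) + tens (a' y) (a y)
  else tens (a' y) (a y).

Lemma last_edge n : X = FinLine n -> is_edge X n = false.
Proof. by move=> ->; rewrite /is_edge /is_vertex /= ltnn andbF. Qed.

Lemma edge0 : is_edge X 0 = false.
Proof. by []. Qed.

Lemma loop_neq0 i x y z :
    coef (tens (a i.+1) (a' i.+1) + tens (a' i) (a i)) (x, y, z) != 0 ->
  [/\ x = i.+1, z = i.+1 & y = i.+2 \/ y = i].
Proof.
rewrite coefD => /add_neq0[]/tens_neq0[].
  by move=> /a_neq0[_ -> ->] /a'_neq0[_ _ ->]; split => //; left.
by move=> /a'_neq0[_ -> ->] /a_neq0[_ _ ->]; split => //; right.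
Qed.

Lemma rel_at_uniq r x y z : wedge_rel r -> coef r (x, y, z) != 0 ->
  r = rel_at x y z.
Proof.
rewrite /rel_at; case=> [i e1 e2|i e1 e2|i e1 e2||n Xn].
- move=> /tens_neq0[/a_neq0[_ -> ->] /a_neq0[_ _ ->]].
  by rewrite eqxx.
- move=> /tens_neq0[/a'_neq0[_ -> _] /a'_neq0[_ _ ->]].
  by rewrite (ltn_eqF (leqW (leqW (leqW (ltnSn i))))) eqxx.
- have i0 : i.+1 == 1%N = false by case: (i) e1.
  move=> /loop_neq0[-> -> yE].
  rewrite (ltn_eqF (leqW (ltnSn _))) i0 e2.
  by case: yE => ->; [rewrite eqxx|rewrite (ltn_eqF (leqW (ltnSn _)))].
- move=> /tens_neq0[/a_neq0[_ -> ->] /a'_neq0[_ _ ->]].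
  by [].
- case: n Xn => [|n] Xn /tens_neq0[/a'_neq0[en -> ->] /a_neq0[_ _ ->]] //=.
  by rewrite !(ltn_eqF (leqW (ltnSn _))) (last_edge Xn).
Qed.

Lemma rel_at_wedge x y z : is_arrow X x y -> is_arrow X y z ->
  wedge_rel (rel_at x y z) /\ coef (rel_at x y z) (x, y, z) = 1.
Proof.
rewrite /rel_at => /arrowP[[-> e1]|[-> e1]] /arrowP[[]|[]].
- move=> -> e2; rewrite eqxx; split; first exact: WedgeUp.
  by rewrite tensE !aE e1 e2 !eqxx mulr1.
- move=> [<-] _; rewrite !(ltn_eqF (leqW (ltnSn _))) eqxx.
  case: (eqVneq x 1%N) e1 => [->|x1] e1.
    by split; [exact: WedgeFirst|rewrite tensE aE a'E e1 !eqxx mulr1].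
  case: x x1 e1 => [|[|x]]// _ e1.
  have e2 : is_edge X x.+1.
    case/andP: e1 => v1 _; rewrite /is_edge v1 andbT.
    by move: v1; rewrite /is_vertex; case: X => // n /ltnW.
  split; first exact: WedgeLoop.
  rewrite coefD !tensE !aE !a'E e1 /= !eqxx mulr1.
  by rewrite !xpair_eqE (gtn_eqF (leqW (ltnSn _))) !andbF mul0r addr0.
- move=> -> e2; rewrite !(ltn_eqF (leqW (ltnSn _))).
  case: ifPn => e3.
    split; first exact: WedgeLoop.
    rewrite coefD !tensE !aE !a'E e1 /= !eqxx mulr1.
    by rewrite !xpair_eqE (ltn_eqF (leqW (ltnSn _))) !andbF mul0r add0r.
  split; last by rewrite tensE aE a'E e1 !eqxx mulr1.
  move: e1 e3; rewrite /is_edge => /andP[_ v1]; rewrite v1 /= => nv.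
  suff XE : X = FinLine y.+1 by exact: (WedgeLast XE).
  move: v1 nv; rewrite /is_vertex; case: X => [n|//] /= v1 nv.
  by congr FinLine; apply/eqP; rewrite eqn_leq v1 andbT leqNgt.
- move=> yz e2; rewrite yz in e1 *; rewrite (ltn_eqF (leqW (leqW (leqW (ltnSn z))))) eqxx.
  split; first exact: WedgeDown.
  by rewrite tensE !a'E e1 e2 !eqxx mulr1.
Qed.

Lemma rel_coef_eq r t p q :
    (forall i, is_edge X i -> is_edge X i.+1 ->
       coef t (i.+1, i.+2, i.+1) = coef t (i.+1, i, i.+1)) ->
  wedge_rel r -> coef r p != 0 -> coef r q != 0 -> coef t p = coef t q.
Proof.
case: p q => [[x y] z] [[x' y'] z'] tl [i e1 e2|i e1 e2|i e1 e2||n Xn].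
- move=> /tens_neq0[/a_neq0[_ -> ->] /a_neq0[_ _ ->]].
  by move=> /tens_neq0[/a_neq0[_ -> ->] /a_neq0[_ _ ->]].
- move=> /tens_neq0[/a'_neq0[_ -> ->] /a'_neq0[_ _ ->]].
  by move=> /tens_neq0[/a'_neq0[_ -> ->] /a'_neq0[_ _ ->]].
- by move=> /loop_neq0[-> -> [->|->]] /loop_neq0[-> -> [->|->]]; rewrite ?tl.
- move=> /tens_neq0[/a_neq0[_ -> ->] /a'_neq0[_ _ ->]].
  by move=> /tens_neq0[/a_neq0[_ -> ->] /a'_neq0[_ _ ->]].
- move=> /tens_neq0[/a'_neq0[_ -> ->] /a_neq0[_ _ ->]].
  by move=> /tens_neq0[/a'_neq0[_ -> ->] /a_neq0[_ _ ->]].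
Qed.

Lemma wedge_sum (c : T2 -> C) x y z : is_arrow X x y -> is_arrow X y z ->
  coef (lsum [set r | wedge_rel r]%classic (fun r => c r *: r)) (x, y, z)
  = c (rel_at x y z).
Proof.
move=> xy yz; have [wr r1] := rel_at_wedge xy yz.
rewrite coef_lsum (fsum_single (i := rel_at x y z)) //=.
  by rewrite coefZ r1 mulr1.
move=> r rr /eqP nr; rewrite coefZ.
case: (eqVneq (coef r (x, y, z)) 0) => [->|/(rel_at_uniq rr)//].
by rewrite mulr0.
Qed.

Lemma wedge_kerP t :
  reflect (forall i, is_edge X i -> is_edge X i.+1 ->
             coef t (i.+1, i.+2, i.+1) = coef t (i.+1, i, i.+1))
          (t \in wedge_ker).
Proof.
apply: (iffP (asboolP _)) => [[c ->] i e1 e2|tl].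
  have [/andP[v0 v1] /andP[_ v2]] := (e1, e2).
  rewrite !wedge_sum /is_arrow ?v0 ?v1 ?v2 ?eqxx ?orbT //.
  rewrite /rel_at !(ltn_eqF (leqW (ltnSn _))) eqxx e2.
  by case: i e1 {e2 v0 v1 v2}.
exists (fun r => if pselect (exists p, coef r p != 0) is left rp
                 then coef t (projT1 (cid rp)) else 0).
apply: coefP => -[[x y] z] /= /andP[xy yz]; rewrite wedge_sum //.
have [wr r1] := rel_at_wedge xy yz.
case: pselect => [rp|[]]; last by exists (x, y, z); rewrite r1 oner_neq0.
case: (cid rp) => q /= rq; apply: (rel_coef_eq tl wr) rq.
by rewrite r1 oner_neq0.
Qed.

Lemma wedge_ker_zmod_closed : zmod_closed wedge_ker.
Proof.
split=> [|t u /wedge_kerP tl /wedge_kerP ul]; apply/wedge_kerP => i e1 e2.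
  by rewrite !coef0.
by rewrite !coefD !coefN tl // ul.
Qed.

HB.instance Definition _ :=
  GRing.isZmodClosed.Build T2 wedge_ker wedge_ker_zmod_closed.

Definition Omega2 : Type := Quotient.quot wedge_ker.
HB.instance Definition _ := GRing.Zmodule.on Omega2.

Definition wedge t : Omega2 := \pi_(Quotient.quot wedge_ker) t.

Lemma wedgeE t u : (wedge t = wedge u) <-> (t - u \in wedge_ker).
Proof. by rewrite Quotient.idealrBE; split => /eqP. Qed.

Lemma wedgeD t u : wedge (t + u) = wedge t + wedge u.
Proof. by rewrite /wedge raddfD. Qed.

Definition d1 w : Omega2 := wedge (tens theta w) + wedge (tens w theta).

Record bimodule_connection := BimoduleConnection {
  nabla : {linear Omega1 -> T2};
  sigma : {linear T2 -> T2};
  sigma_lact : forall f t, sigma (lact2 f t) = lact2 f (sigma t);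
  sigma_ract : forall t f, sigma (ract2 t f) = ract2 (sigma t) f;
  nabla_lact : forall f w, nabla (lact1 f w) = tens (d0 f) w + lact2 f (nabla w);
  nabla_ract : forall w f,
    nabla (ract1 w f) = ract2 (nabla w) f + sigma (tens w (d0 f))
}.

(* Omega1 is a free left A-module on two generators cut down to the existing
   arrows: [gen true] is the sum of all the a_i and [gen false] that of all the
   a_i'.  So t : T2 is a finite sum of pure tensors,
   t = quo true t (x) gen true + quo false t (x) gen false  (lemma [quo_gen]). *)
Definition step (b : bool) (x : nat) : nat := if b then x.+1 else x.-1.
Definition gen (b : bool) : Omega1 := combo (fun p => (p.2 == step b p.1)%:R).
Definition quo (b : bool) t : Omega1 :=
  combo (fun p => coef t (p.1, p.2, step b p.2)).

(* The map s (x) id for s : Omega1 -> T2 right A-linear; characterized by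
   [tens_id_tens]. *)
Definition tens_id (s : Omega1 -> T2) t : T3 :=
  \sum_(b : bool) tens21 (s (quo b t)) (gen b).

(* The extension of a connection to T2: the formula for nabla (w (x) eta) applied
   to the decomposition [quo_gen].  It satisfies that formula for all w and eta
   ([nabla2_tens]), and is the only additive map doing so ([nabla2_uniq]). *)
Definition nabla2 (N : bimodule_connection) t : T3 :=
  \sum_(b : bool) (tens21 (nabla N (quo b t)) (gen b)
    + tens_id (fun eta => sigma N (tens (quo b t) eta)) (nabla N (gen b))).

Definition metric (f f' : nat -> R) : T2 :=
  lsum edges (fun i => (f i)%:C *: tens (a i) (a' i)
                       + (f' i)%:C *: tens (a' i) (a i)).

Definition is_QLC (N : bimodule_connection) (g : T2) : Prop :=
  (forall w, wedge (nabla N w) = d1 w) /\ nabla2 N g = 0.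

Lemma genE b x y : coef (gen b) (x, y) = (is_arrow X x y && (y == step b x))%:R.
Proof. by rewrite coef_combo /=; case: ifPn. Qed.

Lemma step_arrow b x y : is_arrow X x y -> (y == step b x) = (b == (x < y)%N).
Proof.
move=> xy; have := arrowP xy; case: b => /= -[[-> _]|[-> _]].
- by rewrite eqxx ltnSn.
- by rewrite (ltn_eqF (leqW (ltnSn _))) ltnNge leqnSn.
- rewrite ltnSn; case: x {xy} => [|x] //=.
  by rewrite (gtn_eqF (leqW (ltnSn _))).
- by rewrite eqxx ltnNge leqnSn.
Qed.

Lemma step_lt x y : is_arrow X x y -> y = step (x < y)%N x.
Proof. by move=> xy; apply/eqP; rewrite (step_arrow _ xy). Qed.

Lemma sum_gen (F : bool -> C) x y : is_arrow X x y ->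
  \sum_b F b * coef (gen b) (x, y) = F (x < y)%N.
Proof.
move=> xy; rewrite (bigD1 (x < y)%N) //= big1 => [|b bxy].
  by rewrite addr0 genE xy (step_arrow _ xy) eqxx mulr1.
by rewrite genE (step_arrow _ xy) (negPf bxy) andbF mulr0.
Qed.

Lemma quoE b t x y : coef (quo b t) (x, y) = coef t (x, y, step b y).
Proof.
rewrite coef_combo /=; case: ifPn => // nxy.
by rewrite coef_out //= (negPf nxy).
Qed.

Lemma coef_sum (T : Type) (P : pred T) (F : bool -> ({x : T | P x} -> R[i]^o)) x :
  coef (\sum_b F b) x = \sum_b coef (F b) x.
Proof. by rewrite !big_bool coefD. Qed.

Lemma quo_gen t : t = \sum_b tens (quo b t) (gen b).
Proof.
apply: coefP => -[[x y] z] /= /andP[xy yz]; rewrite coef_sum.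
under eq_bigr do rewrite tensE.
by rewrite (sum_gen (fun b => coef (quo b t) (x, y)) yz) quoE -step_lt.
Qed.

(* The coefficient of w on the arrows in direction b, as a function of the
   source vertex: w = \sum_b head b w . gen b. *)
Definition head (b : bool) w : A := combo (fun x => coef w (x, step b x)).

Lemma headE b w x : coef (head b w) x = coef w (x, step b x).
Proof.
rewrite coef_combo /=; case: ifPn => // nx.
by rewrite coef_out // /is_arrow (negPf nx).
Qed.

Lemma head_gen w : w = \sum_b lact1 (head b w) (gen b).
Proof.
apply: coefP => -[x y] /= xy; rewrite coef_sum.
under eq_bigr do rewrite lact1E.
by rewrite (sum_gen (fun b => coef (head b w) x) xy) headE -step_lt.
Qed.

Lemma quo_tens b w eta : quo b (tens w eta) = ract1 w (head b eta).
Proof. by apply: coefP => -[x y] _; rewrite quoE tensE ract1E headE. Qed.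

Lemma tens_lact w f eta : tens w (lact1 f eta) = tens (ract1 w f) eta.
Proof.
by apply: coefP => -[[x y] z] _; rewrite !tensE lact1E ract1E mulrA.
Qed.

Lemma tens_ract w eta f : tens w (ract1 eta f) = ract2 (tens w eta) f.
Proof.
by apply: coefP => -[[x y] z] _; rewrite ract2E !tensE ract1E mulrA.
Qed.

Lemma tens21_lact t f eta : tens21 t (lact1 f eta) = tens21 (ract2 t f) eta.
Proof.
by apply: coefP => -[[[x y] z] v] _; rewrite !tens21E lact1E ract2E mulrA.
Qed.

Lemma tensDl w w' eta : tens (w + w') eta = tens w eta + tens w' eta.
Proof.
by apply: coefP => -[[x y] z] _; rewrite coefD !tensE coefD mulrDl.
Qed.

Lemma tensDr w eta eta' : tens w (eta + eta') = tens w eta + tens w eta'.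
Proof.
by apply: coefP => -[[x y] z] _; rewrite coefD !tensE coefD mulrDr.
Qed.

Lemma tens21Dl t t' eta : tens21 (t + t') eta = tens21 t eta + tens21 t' eta.
Proof.
by apply: coefP => -[[[x y] z] v] _; rewrite coefD !tens21E coefD mulrDl.
Qed.

Lemma tens21Dr t eta eta' : tens21 t (eta + eta') = tens21 t eta + tens21 t eta'.
Proof.
by apply: coefP => -[[[x y] z] v] _; rewrite coefD !tens21E coefD mulrDr.
Qed.

Lemma quoD b t u : quo b (t + u) = quo b t + quo b u.
Proof. by apply: coefP => -[x y] _; rewrite coefD !quoE coefD. Qed.

Lemma quo_lact b f t : quo b (lact2 f t) = lact1 f (quo b t).
Proof. by apply: coefP => -[x y] _; rewrite quoE lact1E lact2E quoE. Qed.

Lemma tens_id_tens (s : Omega1 -> T2) eta zeta :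
    (forall w f, s (ract1 w f) = ract2 (s w) f) ->
  tens_id s (tens eta zeta) = tens21 (s eta) zeta.
Proof.
move=> sr; rewrite {2}(head_gen zeta) /tens_id !big_bool.
by rewrite tens21Dr !quo_tens !sr !tens21_lact.
Qed.

Lemma tens_idD (s : Omega1 -> T2) t u : {morph s : x y / x + y} ->
  tens_id s (t + u) = tens_id s t + tens_id s u.
Proof.
move=> sD; rewrite /tens_id -big_split; apply: eq_bigr => b _ /=.
by rewrite quoD sD tens21Dl.
Qed.

Lemma nabla2D N t u : nabla2 N (t + u) = nabla2 N t + nabla2 N u.
Proof.
rewrite /nabla2 -big_split; apply: eq_bigr => b _ /=.
rewrite quoD raddfD tens21Dl addrACA; congr (_ + _).
rewrite /tens_id -big_split; apply: eq_bigr => c _ /=.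
by rewrite tensDl raddfD tens21Dl.
Qed.

Lemma nabla2_tens N w eta : nabla2 N (tens w eta) =
  tens21 (nabla N w) eta
  + tens_id (fun zeta => sigma N (tens w zeta)) (nabla N eta).
Proof.
have sr : forall u f, sigma N (tens w (ract1 u f)) = ract2 (sigma N (tens w u)) f.
  by move=> u f; rewrite tens_ract sigma_ract.
have sD : {morph (fun zeta => sigma N (tens w zeta)) : x y / x + y}.
  by move=> x y; rewrite tensDr raddfD.
rewrite {2 3}(head_gen eta) /nabla2 !big_bool (raddfD (nabla N)) /= tens21Dr tens_idD //.
rewrite [RHS]addrACA; congr (_ + _);
  rewrite quo_tens nabla_ract tens21Dl tens21_lact -addrA; congr (_ + _);
  rewrite nabla_lact tens_idD // tens_id_tens //; congr (_ + _);
  by rewrite /tens_id; apply: eq_bigr => b _; rewrite quo_lact tens_lact.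
Qed.

Lemma nabla2_uniq N (D : T2 -> T3) :
    {morph D : t u / t + u} ->
    (forall w eta, D (tens w eta) =
       tens21 (nabla N w) eta
       + tens_id (fun zeta => sigma N (tens w zeta)) (nabla N eta)) ->
  D =1 nabla2 N.
Proof.
move=> DD Dt t; rewrite (quo_gen t) big_bool DD !Dt.
by rewrite nabla2D !nabla2_tens.
Qed.

Lemma metric_up (f f' : nat -> R) i : is_edge X i ->
  coef (metric f f') (i, i.+1, i) = (f i)%:C.
Proof.
move=> e; rewrite coef_lsum (fsum_single (i := i)) // => [|j _ ji].
  rewrite coefD !coefZ !tensE !aE !a'E e !eqxx !xpair_eqE.
  by rewrite (ltn_eqF (ltnSn i)) /= !mulr1 mul0r mulr0 addr0.
rewrite coefD !coefZ !tensE !aE !a'E !xpair_eqE eqSS (eq_sym i j) (negPf ji).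
rewrite !andbF mul0r mulr0 add0r; case: eqP => [->|]; last first.
  by rewrite !andbF mul0r mulr0.
by rewrite (gtn_eqF (leqW (ltnSn j))) !andbF mul0r mulr0.
Qed.

Lemma metric_down (f f' : nat -> R) i : is_edge X i ->
  coef (metric f f') (i.+1, i, i.+1) = (f' i)%:C.
Proof.
move=> e; rewrite coef_lsum (fsum_single (i := i)) // => [|j _ ji].
  rewrite coefD !coefZ !tensE !aE !a'E e !eqxx !xpair_eqE.
  by rewrite (gtn_eqF (ltnSn i)) /= !mulr1 mul0r mulr0 add0r.
rewrite coefD !coefZ !tensE !aE !a'E !xpair_eqE !eqSS (eq_sym i j) (negPf ji).
rewrite !andbF mul0r mulr0 addr0; case: eqP => [<-|]; last first.
  by rewrite !andbF mul0r mulr0.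
by rewrite (ltn_eqF (leqW (ltnSn i))) !andbF mul0r mulr0.
Qed.

Lemma metric_out (f f' : nat -> R) x y z : x != z -> coef (metric f f') (x, y, z) = 0.
Proof.
move=> xz; rewrite coef_lsum fsbig1 // => j _.
apply/eqP; apply: contraNT xz; rewrite coefD !coefZ => /add_neq0[];
  rewrite mulf_eq0 negb_or => /andP[_ /tens_neq0[]].
  by move=> /a_neq0[_ -> _] /a'_neq0[_ _ ->].
by move=> /a'_neq0[_ -> _] /a_neq0[_ _ ->].
Qed.

End Calculus.

Arguments metric {R} X f f'.

(* Main.v *)
Require Import Defs.
From mathcomp Require Import all_boot all_order all_algebra reals complex.
(* Gives [coef0], [coefD] and so on back their meaning in [Defs], which [poly]
   shadows. *)
Import Defs.
Import GRing.Theory Num.Theory.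
Local Open Scope ring_scope.

(** Since there is no two-step path between adjacent vertices, a bimodule map
    from [Omega1] to [T2] vanishes, so every bimodule connection is
    nabla w = theta (x) w - sigma (w (x) theta), and nabla g = 0 reads
    theta (x) g = sigma_12 sigma_23 (g (x) theta).  Write p for the product of
    the coefficients of sigma 1-2-1 |-> 1-2-1 and 2-1-2 |-> 2-1-2, and q for that
    of 2-3-2 |-> 2-1-2 and 3-2-1 |-> 3-2-1.  On the paths 1-2-1-2, 3-2-1-2 and
    2-1-2-1 the equation says f1' = f1 p, f1' = f2' q and f1 = f2 q + f1' p, and
    for f = f' this is f1 = 2 f1. *)

Section Connection.
Context {R : realType} {X : line_graph}.
Local Notation Omega1 := (Omega1 R X).
Local Notation theta := (@theta R X).
Local Notation gen := (@gen R X).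
Local Notation T2 := (T2 R X).
Implicit Types (w eta : Omega1) (t : T2) (f : Afun R X).

Definition vertex_ind (x : nat) : Afun R X := combo (fun y => (y == x)%:R).

Definition path_ind (x y z : nat) : T2 := combo (fun p => (p == (x, y, z))%:R).

Lemma vertex_indE x y : coef (vertex_ind x) y = (is_vertex X y && (y == x))%:R.
Proof. by rewrite coef_combo; case: ifP. Qed.

Lemma path_indE x y z x' y' z' : is_arrow X x' y' -> is_arrow X y' z' ->
  coef (path_ind x y z) (x', y', z') = ((x', y', z') == (x, y, z))%:R.
Proof. by move=> xy yz; rewrite coef_combo /= xy yz. Qed.

Lemma path_ind_out x y z : ~~ (is_arrow X x y && is_arrow X y z) ->
  path_ind x y z = 0.
Proof.
move=> nP; apply: coefP => -[[x' y'] z'] /andP[/= xy yz].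
rewrite coef0 path_indE //; case: eqP => // -[ex ey ez].
by rewrite -ex -ey -ez xy yz in nP.
Qed.

Lemma arrow_neq {x y} : is_arrow X x y -> (x == y) = false.
Proof.
by case/and3P => _ _ /orP[]/eqP->; rewrite ?(ltn_eqF (ltnSn _)) ?(gtn_eqF (ltnSn _)).
Qed.

Lemma arrow_parity {x y} : is_arrow X x y -> odd x != odd y.
Proof. by case/and3P => _ _ /orP[]/eqP-> /=; case: odd. Qed.

(** Cuts a possibly infinite combination down to a finite one, to which linearity of [sigma]
    applies. Terms whose indices do not form a path are 0. *)
Lemma localize_path t x z :
  ract2 (lact2 (vertex_ind x) t) (vertex_ind z) =
  \sum_(b : bool) coef t (x, step b x, z) *: path_ind x (step b x) z.
Proof.
apply: coefP => -[[x' y'] z'] /andP[/= xy yz].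
have [/and3P[vx vy _] /and3P[_ vz _]] := (xy, yz).
rewrite coef_sum ract2E lact2E !vertex_indE vx vz /=.
have [ex|nx] := eqVneq x' x; last first.
  rewrite !mul0r big1 // => b _.
  by rewrite coefZ path_indE // !xpair_eqE (negPf nx) mulr0.
rewrite mul1r; have [ez|nz] := eqVneq z' z; last first.
  rewrite mulr0 big1 // => b _.
  by rewrite coefZ path_indE // !xpair_eqE (negPf nz) andbF mulr0.
rewrite mulr1 -ex -ez [in LHS](step_lt xy).
rewrite -(sum_gen (fun b => coef t (x', step b x', z')) xy).
apply: eq_bigr => b _.
by rewrite coefZ path_indE // genE xy !xpair_eqE !eqxx andbT.
Qed.

Context (N : bimodule_connection R X).

(** Entry of [sigma] from the path x-u-z to x-y-z: a bimodule map fixes both ends, so only the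
    middle vertex can move. *)
Definition sigma_mx (x u z y : nat) : R[i] :=
  coef (sigma N (path_ind x u z)) (x, y, z).

Lemma sigma_mx_out x u z y :
  ~~ (is_arrow X x y && is_arrow X y z) -> sigma_mx x u z y = 0.
Proof. by move=> nP; rewrite /sigma_mx coef_out. Qed.

Lemma sigma_mx_in x u z y :
  ~~ (is_arrow X x u && is_arrow X u z) -> sigma_mx x u z y = 0.
Proof. by move=> nP; rewrite /sigma_mx path_ind_out // raddf0 coef0. Qed.

Lemma sigmaE t x y z : coef (sigma N t) (x, y, z) =
  \sum_(b : bool) coef t (x, step b x, z) * sigma_mx x (step b x) z y.
Proof.
have [/andP[xy yz]|nP] := boolP (is_arrow X x y && is_arrow X y z); last first.
  by rewrite coef_out // big1 // => b _; rewrite sigma_mx_out // mulr0.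
have [/and3P[vx _ _] /and3P[_ vz _]] := (xy, yz).
(* [sigma] commutes with the cut to the ends [x] and [z], and the cut keeps the coefficient at
   x-y-z. *)
transitivity (coef (sigma N (ract2 (lact2 (vertex_ind x) t) (vertex_ind z)))
                (x, y, z)).
  by rewrite sigma_ract sigma_lact ract2E lact2E !vertex_indE vx vz !eqxx mul1r mulr1.
rewrite localize_path !big_bool linearD !linearZ /= coefD !coefZ; reflexivity.
Qed.

(** Both Leibniz rules are applied to [h w k], which is 0 for [h], [k] the indicators of the ends of
    a two-step path; the coefficient at that path is the claim. *)
Lemma nabla_inner w : nabla N w = tens theta w - sigma N (tens w theta).
Proof.
apply: coefP => -[[x y] z] /andP[/= xy yz].
have [/and3P[vx vy _] /and3P[_ vz _]] := (xy, yz).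
set h : Afun R X := vertex_ind x; set k : Afun R X := vertex_ind z.
have w0 : ract1 (lact1 h w) k = 0.
  apply: coefP => -[x' z'] /= xz'; rewrite coef0 ract1E lact1E !vertex_indE.
  have [ex|_] := eqVneq x' x; last by rewrite andbF !mul0r.
  have [ez|_] := eqVneq z' z; last by rewrite andbF !mulr0.
  (* Two steps preserve parity while an arrow changes it. *)
  have := arrow_parity xz'; rewrite ex ez.
  by move: (arrow_parity xy) (arrow_parity yz); do 3!case: odd.
have := congr1 (fun u : T2 => coef u (x, y, z)) (nabla_ract N (lact1 h w) k).
rewrite w0 raddf0 coef0 coefD ract2E nabla_lact coefD tensE lact2E d0E xy.
(* On arrows into [z] the form [d0 k] has coefficient 1, as [theta] does. *)
have -> : coef (sigma N (tens (lact1 h w) (d0 k))) (x, y, z) =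
          coef (sigma N (tens w theta)) (x, y, z).
  rewrite !sigmaE; apply: eq_bigr => b _.
  have [/andP[xu uz]|nP] :=
    boolP (is_arrow X x (step b x) && is_arrow X (step b x) z); last first.
    by rewrite sigma_mx_in // !mulr0.
  rewrite !tensE lact1E d0E thetaE uz !vertex_indE vx vz !eqxx (arrow_neq uz) andbF.
  by rewrite mul1r subr0.
rewrite !vertex_indE vx vy vz !eqxx eq_sym (arrow_neq xy) /= mulr1 mul1r.
rewrite coefD coefN tensE thetaE xy mul1r sub0r mulN1r => /eqP.
by rewrite addrAC eq_sym addrC addr_eq0 => /eqP ->; rewrite opprD opprK.
Qed.

(** By [nabla_inner] for both factors: the two terms sigma(w (x) theta) (x) eta cancel. *)
Lemma nabla2_inner w eta : nabla2 N (tens w eta) =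
  tens21 (tens theta w) eta
  - tens_id (fun u => sigma N (tens w u)) (sigma N (tens eta theta)).
Proof.
have sD : {morph (fun u => sigma N (tens w u)) : u v / u + v}.
  by move=> u v; rewrite tensDr raddfD.
have sr u g : sigma N (tens w (ract1 u g)) = ract2 (sigma N (tens w u)) g.
  by rewrite tens_ract sigma_ract.
have tensE2 u : tens theta u = nabla N u + sigma N (tens u theta).
  by rewrite nabla_inner subrK.
have B := tens_id_tens theta eta sr.
rewrite tensE2 tens_idD // in B.
by rewrite nabla2_tens tensE2 tens21Dl -B addrA addrK.
Qed.

Lemma tens_idE (s : Omega1 -> T2) t x y z v : is_arrow X z v ->
  coef (tens_id s t) (x, y, z, v) = coef (s (quo (z < v)%N t)) (x, y, z).
Proof.
move=> zv; rewrite -(sum_gen (fun b => coef (s (quo b t)) (x, y, z)) zv).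
by rewrite /tens_id !big_bool coefD !tens21E.
Qed.

Lemma sigma_gen_theta b x y z :
  coef (sigma N (tens (gen b) theta)) (x, y, z) = sigma_mx x (step b x) z y.
Proof.
rewrite sigmaE (bigD1 b) //= big1 => [|d db].
  have [/andP[xu uz]|nP] :=
    boolP (is_arrow X x (step b x) && is_arrow X (step b x) z); last first.
    by rewrite sigma_mx_in // mulr0 addr0.
  by rewrite tensE genE thetaE xu uz eqxx !mul1r addr0.
rewrite tensE genE; case: (boolP (is_arrow X x (step d x))) => [xd|_].
  have := step_arrow d xd; rewrite eqxx => /esym/eqP dE.
  by rewrite (step_arrow b xd) -dE eq_sym (negPf db) !mul0r.
by rewrite !mul0r.
Qed.

(* Coefficientwise, nabla t = theta (x) t - sigma_12 sigma_23 (t (x) theta). *)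
Lemma nabla2E t x y z v : is_arrow X x y -> is_arrow X y z -> is_arrow X z v ->
  coef (nabla2 N t) (x, y, z, v) = coef t (y, z, v) -
  \sum_(b : bool) \sum_(c : bool)
    coef t (x, step b x, step c (step b x))
    * sigma_mx (step b x) (step c (step b x)) v z * sigma_mx x (step b x) z y.
Proof.
move=> xy yz zv.
have nE : nabla2 N t = \sum_(b : bool) nabla2 N (tens (quo b t) (gen b)).
  by rewrite [in LHS](quo_gen t) big_bool nabla2D big_bool.
rewrite nE; under eq_bigr do rewrite nabla2_inner.
rewrite sumrB coefD coefN; congr (_ - _).
  rewrite big_bool coefD !tens21E !tensE thetaE xy !mul1r !quoE.
  have := sum_gen (fun b => coef t (y, z, step b z)) zv.
  by rewrite big_bool -(step_lt zv).
have -> : coef (\sum_(b : bool) tens_id (fun u => sigma N (tens (quo b t) u))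
                   (sigma N (tens (gen b) theta))) (x, y, z, v) =
    \sum_(b : bool) coef (sigma N (tens (quo b t)
      (quo (z < v)%N (sigma N (tens (gen b) theta))))) (x, y, z).
  by rewrite !big_bool coefD !tens_idE.
under eq_bigr do rewrite sigmaE.
(* The outer sum came from [gen] and runs over the second step of the path in [t]; it becomes the
   inner one. *)
rewrite exchange_big; apply: eq_bigr => b _; apply: eq_bigr => c _.
by rewrite tensE !quoE -(step_lt zv) sigma_gen_theta.
Qed.

End Connection.

Theorem mainTheorem4 (R : realType) (X : line_graph)
    (hX : (exists2 n : nat, (2 < n)%N & X = FinLine n) \/ X = HalfLine)
    (f f' : nat -> R)
    (f_neq0 : forall i : nat, is_edge X i -> f i != 0)
    (f'_neq0 : forall i : nat, is_edge X i -> f' i != 0)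
    (f_sym : forall i : nat, is_edge X i -> f i = f' i) :
  ~ exists N : bimodule_connection R X, is_QLC N (metric X f f').
Proof.
case=> N [_ Ng].
(* Here n > 2 enters; whether 4 is a vertex is left open. *)
have [v1 v2 v3] : [/\ is_vertex X 1, is_vertex X 2 & is_vertex X 3].
  case: hX => [[n n2 ->]|->] //; rewrite /is_vertex /= n2.
  by rewrite (ltnW n2) (ltnW (ltnW n2)).
have e1 : is_edge X 1 by rewrite /is_edge v1 v2.
have e2 : is_edge X 2 by rewrite /is_edge v2 v3.
have [a12 a21 a32] : [/\ is_arrow X 1 2, is_arrow X 2 1 & is_arrow X 3 2].
  by rewrite /is_arrow v1 v2 v3; split.
have Ng0 x y z v : is_arrow X x y -> is_arrow X y z -> is_arrow X z v ->
    coef (metric X f f') (y, z, v) = \sum_(b : bool) \sum_(c : bool)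
    coef (metric X f f') (x, step b x, step c (step b x))
    * sigma_mx N (step b x) (step c (step b x)) v z * sigma_mx N x (step b x) z y.
  by move=> xy yz zv; apply/eqP; rewrite -subr_eq0 -nabla2E // Ng coef0.
have eq1212 := Ng0 1%N 2%N 1%N 2%N a12 a21 a12.
have eq3212 := Ng0 3%N 2%N 1%N 2%N a32 a21 a12.
have eq2121 := Ng0 2%N 1%N 2%N 1%N a21 a12 a21.
rewrite !big_bool /= in eq1212 eq3212 eq2121.
(* The source would pass through 0, beyond the end of the line. *)
have no101 : sigma_mx N 1 0 1 2 = 0.
  by rewrite sigma_mx_in // /is_arrow andbF.
(* The target would be 4-1-2, but 4 and 1 are not adjacent. *)
have no412 : sigma_mx N 4 3 2 1 = 0.
  by rewrite sigma_mx_out // /is_arrow /= !andbF.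
rewrite (metric_out X f f' 2 (isT : 1%N != 3%N)) no101 !(mul0r, mulr0, addr0, add0r)
  in eq1212.
rewrite (metric_out X f f' 4 (isT : 3%N != 5%N)) (metric_out X f f' 2 (isT : 3%N != 1%N))
  no412 !(mul0r, mulr0, addr0, add0r) in eq3212.
rewrite (metric_out X f f' 3 (isT : 2%N != 4%N)) (metric_out X f f' 1 (isT : 2%N != 0%N))
  no101 !(mul0r, mulr0, addr0, add0r) in eq2121.
rewrite !metric_up ?metric_down // -!f_sym // in eq1212 eq3212 eq2121.
(* With the [sigma] factors swapped, the summands are the right sides of [eq3212] and [eq1212], so
   each equals f1. *)
rewrite mulrAC -eq3212 [X in _ + X]mulrAC -eq1212 in eq2121.
move/eqP: eq2121; rewrite -subr_eq0 opprD addNKr oppr_eq0 => /eqP[/eqP].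
exact/negP/f_neq0.
Qed.
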